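(* Let $\mathbb{k}$ be a field, $n\ge2$, and let $\alpha\in\Pi^+$. Then the stabilizer of $\nu_{\mathrm{id},[\alpha]}$ for the action of $\mathrm{Tame}(\mathbb{k}^n)$ on $\mathbf{X}_n$ is the semidirect product of $M_\alpha$ (normal factor) and $L_\alpha$: $$\mathrm{Stab}(\nu_{\mathrm{id},[\alpha]})=M_\alpha\rtimes L_\alpha.$$
   Context: $\mathrm{Aut}(\mathbb{k}^n)$ is the group (under composition) of polynomial automorphisms $g=(g_1,\dots,g_n)$, $g_i\in\mathbb{k}[x_1,\dots,x_n]$, of affine $n$-space. $\mathrm{Tame}(\mathbb{k}^n)$ is the subgroup generated by $\mathrm{GL}_n(\mathbb{k})$ and the elementary automorphisms $(x_1,\dots,x_n)\mapsto(x_1+P(x_2,\dots,x_n),x_2,\dots,x_n)$. For $g\in\mathrm{Aut}(\mathbb{k}^n)$ and a polynomial $P$, $g^*P:=P(g_1,\dots,g_n)$; the group acts on the left on valuations $\nu:\mathbb{k}[x_1,\dots,x_n]\to\mathbb{R}\cup\{+\infty\}$ by $(g\cdot\nu)(P)=\nu(g^*P)$, and hence on classes of valuations modulo multiplication by positive reals. Let $\Pi=\{\alpha\in\mathbb{R}^n:\alpha_i>0\ \forall i\}$ and $\Pi^+=\{\alpha\in\Pi:\alpha_1\ge\dots\ge\alpha_n\}$; $[\alpha]$ is the class of $\alpha$ modulo positive scaling. For $\alpha\in\Pi$ set $\nu_{\mathrm{id},\alpha}\big(\sum_I c_Ix_1^{i_1}\cdots x_n^{i_n}\big)=\min_{I:\,c_I\ne0}\big(-\sum_k\alpha_ki_k\big)$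 (and $+\infty$ for the zero polynomial), and $\nu_{f,\alpha}=f\cdot\nu_{\mathrm{id},\alpha}$ for $f\in\mathrm{Tame}(\mathbb{k}^n)$; the class of $\nu_{f,\alpha}$ modulo positive scaling depends only on $[\alpha]$ and is denoted $\nu_{f,[\alpha]}$. $\mathbf{X}_n$ is the set of all classes $\nu_{f,[\alpha]}$, $f\in\mathrm{Tame}(\mathbb{k}^n)$, $\alpha\in\Pi$. For $\alpha\in\Pi^+$ write $\alpha=(\gamma_1,\dots,\gamma_1,\dots,\gamma_r,\dots,\gamma_r)$ with $\gamma_1>\dots>\gamma_r>0$, where $\gamma_i$ is repeated $m_i$ times, so $\sum m_i=n$. $L_\alpha\simeq\mathrm{GL}_{m_1}(\mathbb{k})\times\dots\times\mathrm{GL}_{m_r}(\mathbb{k})$ is the subgroup of $\mathrm{GL}_n(\mathbb{k})$ of block diagonal matrices with blocks of sizes $m_1,\dots,m_r$. For an index $i$, let $b(i)\in\{1,\dots,r\}$ be such that $\alpha_i=\gamma_{b(i)}$. $M_\alpha$ is the group of automorphisms of the form $(x_1,\dots,x_n)\mapsto(x_1+P_1,\dots,x_i+P_i,\dots,x_n+c)$ with $c\in\mathbb{k}$, where each $P_i$ is a polynomial satisfying $\alpha_i\ge-\nu_{\mathrm{id},\alpha}(P_i)$ and depending only on the variables $x_j$ with $b(j)>b(i)$. *)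

(* Defs.v *)
From HB Require Import structures.
From mathcomp Require Import all_boot all_order all_algebra.
From mathcomp Require Import boolp classical_sets reals mpoly.
(* The notations of [constructive_ereal] and [mpoly] cannot be loaded together. *)
From mathcomp Require Import -(notations) constructive_ereal.

Set Implicit Arguments.
Unset Strict Implicit.
Unset Printing Implicit Defensive.

Import Order.TTheory GRing.Theory Num.Theory.
Local Open Scope classical_set_scope.
Local Open Scope ring_scope.

Section GroupTheory.
Context {G : groupType}.
Implicit Types S H N L : set G.

Definition is_subgroup H : Prop := group_closed (mem H).

Definition subgroup_generated S : set G := smallest is_subgroup S.

(* Internal semidirect product: H = N ><| L. *)
Record is_sdprod N L H : Prop := IsSdprod {
  sdprod_group : is_subgroup H;
  sdprod_kernel : is_subgroup N;
  sdprod_compl : is_subgroup L;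
  sdprod_kernel_sub : N `<=` H;
  sdprod_compl_sub : L `<=` H;
  sdprod_normal : forall x h, N x -> H h -> N (x ^ h)%g;
  sdprod_trivI : N `&` L = [set 1%g];
  sdprod_mul : H = [set (x * y)%g | x in N & y in L]
}.

Lemma subgroup_generated_group S : is_subgroup (subgroup_generated S).
Proof.
split; first by apply/mem_set => H [[H1 _] _]; exact: set_mem.
move=> x y /set_mem Sx /set_mem Sy; apply/mem_set => H [[H1 HB] SH].
by apply/set_mem/HB; apply/mem_set; [apply: Sx|apply: Sy].
Qed.

End GroupTheory.

(* The polynomial map (g_1, ..., g_n) is the tuple of its components. *)
Section PolynomialMaps.
Context {k : fieldType} {n : nat}.
Local Notation pmap := (n.-tuple {mpoly k[n]}).
Implicit Types f g h : pmap.

Definition pmap_id : pmap := [tuple 'X_i | i < n].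

Definition pmap_comp g h : pmap := [tuple tnth g i \mPo h | i < n].

Lemma pmap_compE g h (P : {mpoly k[n]}) : P \mPo pmap_comp g h = (P \mPo g) \mPo h.
Proof.
rewrite [P \mPo g]comp_mpolyE [LHS]comp_mpolyE raddf_sum /=.
apply: eq_bigr => m _; rewrite comp_mpolyZ rmorph_prod /=; congr (_ *: _).
by apply: eq_bigr => i _; rewrite tnth_mktuple rmorphXn.
Qed.

Lemma pmap_compA : associative pmap_comp.
Proof.
by move=> f g h; apply: eq_from_tnth => i; rewrite !tnth_mktuple pmap_compE.
Qed.

Lemma pmap_comp1l : left_id pmap_id pmap_comp.
Proof.
move=> g; apply: eq_from_tnth => i.
by rewrite !tnth_mktuple comp_mpolyXU (tnth_nth 0).
Qed.

Lemma pmap_comp1r : right_id pmap_id pmap_comp.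
Proof.
by move=> g; apply: eq_from_tnth => i; rewrite tnth_mktuple comp_mpoly_id.
Qed.

End PolynomialMaps.

Section Aut.
Variables (k : fieldType) (n : nat).
Local Notation pmap := (n.-tuple {mpoly k[n]}).

Definition inverse_pmaps (p : pmap * pmap) : bool :=
  (pmap_comp p.1 p.2 == pmap_id) && (pmap_comp p.2 p.1 == pmap_id).

(* Aut(k^n): an automorphism is stored with its inverse, which is unique. *)
Record polyaut := PolyAut {
  polyaut_pair : pmap * pmap;
  _ : inverse_pmaps polyaut_pair
}.

HB.instance Definition _ := [isSub for polyaut_pair].
HB.instance Definition _ := [Choice of polyaut by <:].

Definition polyaut_map (g : polyaut) : pmap := (polyaut_pair g).1.

Lemma polyaut_map_inj : injective polyaut_map.
Proof.
move=> [[g g'] gP] [[h h'] hP]; rewrite /polyaut_map /= => gh; subst h.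
apply: val_inj => /=; congr (_, _).
move: gP hP => /andP[/= _ /eqP g'g] /andP[/= /eqP gh' _].
by rewrite -[g']pmap_comp1r -gh' pmap_compA g'g pmap_comp1l.
Qed.

Fact polyaut_one_subproof : inverse_pmaps (pmap_id, pmap_id).
Proof. by rewrite /inverse_pmaps /= pmap_comp1l eqxx. Qed.

Definition polyaut_one := PolyAut polyaut_one_subproof.

Fact polyaut_inv_subproof (g : polyaut) :
  inverse_pmaps ((polyaut_pair g).2, (polyaut_pair g).1).
Proof. by case: g => p /=; rewrite /inverse_pmaps andbC. Qed.

Definition polyaut_inv (g : polyaut) := PolyAut (polyaut_inv_subproof g).

Fact polyaut_mul_subproof (g h : polyaut) :
  inverse_pmaps (pmap_comp (polyaut_pair g).1 (polyaut_pair h).1,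
                 pmap_comp (polyaut_pair h).2 (polyaut_pair g).2).
Proof.
case: g h => [[g g'] /andP[/= /eqP gg' /eqP g'g]].
case=> [[h h'] /andP[/= /eqP hh' /eqP h'h]]; rewrite /inverse_pmaps /=.
rewrite -pmap_compA (pmap_compA h) hh' pmap_comp1l gg' eqxx /=.
by rewrite -pmap_compA (pmap_compA g') g'g pmap_comp1l h'h.
Qed.

Definition polyaut_mul (g h : polyaut) := PolyAut (polyaut_mul_subproof g h).

Fact polyaut_mulA : associative polyaut_mul.
Proof. by move=> f g h; apply: polyaut_map_inj; exact: pmap_compA. Qed.

Fact polyaut_mul1g : left_id polyaut_one polyaut_mul.
Proof. by move=> g; apply: polyaut_map_inj; exact: pmap_comp1l. Qed.

Fact polyaut_mulg1 : right_id polyaut_one polyaut_mul.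
Proof. by move=> g; apply: polyaut_map_inj; exact: pmap_comp1r. Qed.

Fact polyaut_mulVg : left_inverse polyaut_one polyaut_inv polyaut_mul.
Proof.
by case=> [[g g'] gP]; apply: polyaut_map_inj; have /andP[_ /eqP] := gP.
Qed.

Fact polyaut_mulgV : right_inverse polyaut_one polyaut_inv polyaut_mul.
Proof.
by case=> [[g g'] gP]; apply: polyaut_map_inj; have /andP[/eqP] := gP.
Qed.

HB.instance Definition _ := isGroup.Build polyaut
  polyaut_mulA polyaut_mul1g polyaut_mulg1 polyaut_mulVg polyaut_mulgV.

Definition polyaut_comp (g : polyaut) (i : 'I_n) : {mpoly k[n]} :=
  tnth (polyaut_map g) i.

(* g^* P = P(g_1, ..., g_n) *)
Definition pullback (g : polyaut) (P : {mpoly k[n]}) : {mpoly k[n]} :=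
  P \mPo polyaut_map g.

Definition depends_only_on (V : pred 'I_n) (P : {mpoly k[n]}) : Prop :=
  forall m, m \in msupp P -> forall j, m j != 0%N -> V j.

Definition is_linear_of (A : 'M[k]_n) (g : polyaut) : Prop :=
  forall i, polyaut_comp g i = \sum_j A i j *: 'X_j.

Definition GL_aut : set polyaut :=
  [set g | exists2 A, A \in unitmx & is_linear_of A g].

(* The variable x_1 has index 0 in 'I_n. *)
Definition elementary_aut : set polyaut :=
  [set g | exists2 P, depends_only_on (fun j => j != 0%N :> nat) P &
     forall i, polyaut_comp g i = if i == 0%N :> nat then 'X_i + P else 'X_i].

Definition Tame : set polyaut :=
  subgroup_generated (GL_aut `|` elementary_aut).

End Aut.

Section Valuations.
Variables (R : realType) (k : fieldType) (n : nat).
Implicit Types (f g : polyaut k n) (P : {mpoly k[n]}) (a : 'I_n -> R).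

Definition Pi : set ('I_n -> R) := [set a | forall i, 0 < a i].

Definition PiPlus : set ('I_n -> R) :=
  [set a | Pi a /\ forall i j : 'I_n, (i <= j)%N -> a j <= a i].

(* [extended R] also contains -oo, which the valuations in X_n never take. *)
Definition valuation := {mpoly k[n]} -> extended R.
Implicit Types nu mu : valuation.

Definition nu_id a : valuation := fun P =>
  \big[Order.min/EPInf R]_(m <- msupp P) EFin (- \sum_i a i * (m i)%:R).

Definition act g nu : valuation := fun P => nu (pullback g P).

Definition nu_ f a : valuation := act f (nu_id a).

(* Class of a valuation modulo multiplication by positive reals. *)
Definition vclass nu : set valuation :=
  [set mu | exists2 c : R, 0 < c & forall P, mu P = mule (EFin c) (nu P)].

Definition act_class g (C : set valuation) : set valuation :=
  [set act g nu | nu in C].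

Definition Xn : set (set valuation) :=
  [set C | exists f a, [/\ Tame f, Pi a & C = vclass (nu_ f a)]].

Lemma act1 nu : act 1%g nu = nu.
Proof. by apply/funext => P; rewrite /act /pullback comp_mpoly_id. Qed.

Lemma actM f g nu : act (f * g)%g nu = act f (act g nu).
Proof. by apply/funext => P; rewrite /act /pullback pmap_compE. Qed.

Lemma vclassP nu mu : vclass nu = vclass mu <-> vclass nu mu.
Proof.
split=> [-> | [c c0 muE]]; first by exists 1 => // P; rewrite mul1e.
apply/seteqP; split=> x [d d0 xE].
  exists (d / c); rewrite ?divr_gt0 // => P.
  by rewrite xE muE muleA -EFinM divfK ?gt_eqF.
exists (d * c); rewrite ?mulr_gt0 // => P.
by rewrite xE muE muleA -EFinM.
Qed.

Lemma act_class_vclass g nu : act_class g (vclass nu) = vclass (act g nu).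
Proof.
apply/seteqP; split=> [_ [mu [c c0 muE] <-] | mu [c c0 muE]].
  by exists c => // P; rewrite /act muE.
exists (fun P => mule (EFin c) (nu P)); first by exists c.
by apply/funext => P; rewrite muE.
Qed.

Lemma Tame_act_class g (x : Xn) : Tame g -> act_class g (val x) \in Xn.
Proof.
case: x => C /= /set_mem[f [a [Tf a0 ->]]] Tg; apply/mem_set.
exists (g * f)%g, a; split=> //; last by rewrite act_class_vclass /nu_ actM.
apply/set_mem; apply: group_closedM; try exact: mem_set.
exact: subgroup_generated_group.
Qed.

Lemma nu_Xn f a : Tame f -> Pi a -> vclass (nu_ f a) \in Xn.
Proof. by move=> Tf a0; apply/mem_set; exists f, a. Qed.

Lemma nu_1_Xn a : Pi a -> vclass (nu_id a) \in Xn.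
Proof.
move=> a0; rewrite -(act1 (nu_id a)); apply: nu_Xn => //.
apply/set_mem; exact: (subgroup_generated_group _).1.
Qed.

(* The action of Tame(k^n) on X_n. *)
Definition tame_act g (Tg : Tame g) (x : Xn) : Xn :=
  SigSub (Tame_act_class x Tg).

Definition tame_stab (x : Xn) : set (polyaut k n) :=
  [set g | exists Tg : Tame g, tame_act Tg x = x].

(* The class of nu_(id, a), as a point of X_n. *)
Definition nu_id_class a (a_gt0 : Pi a) : Xn := SigSub (nu_1_Xn a_gt0).

(* For a in PiPlus this is gamma_1 > ... > gamma_r, since [undup] keeps the
   order. The block index b(i) is counted from 0. *)
Definition weights a : seq R := undup (codom a).

Definition block a (i : 'I_n) : nat := index (a i) (weights a).

Definition L_ a : set (polyaut k n) :=
  [set g | exists A : 'M[k]_n,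
     [/\ A \in unitmx, forall i j, block a i != block a j -> A i j = 0
       & is_linear_of A g]].

Definition M_ a : set (polyaut k n) :=
  [set g | exists (P : 'I_n -> {mpoly k[n]}) (c : k),
     [/\ forall i, (oppe (nu_id a (P i)) <= EFin (a i))%O,
         forall i, depends_only_on (fun j => block a i < block a j)%N (P i),
         forall i : 'I_n, i.+1 = n -> P i = c%:MP
       & forall i, polyaut_comp g i = 'X_i + P i]].

End Valuations.

Arguments L_ {R} k {n}.
Arguments M_ {R} k {n}.
Arguments nu_id_class {R} k {n a}.

(* Main.v *)
(** Filter the polynomials by weighted degree. A map stabilizing the class of
    [nu_(id, alpha)] rescales degrees by a constant, and looking at a variable
    of least weight, for the map and for its inverse, shows that the constant
    is 1. So the stabilizer consists of the tame [g] such that [g] and its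
    inverse preserve the filtration. Such a [g] has components
    [g_i = l_i + Q_i], where [l_i] is a linear form in the variables of weight
    [alpha_i] and [Q_i] only involves variables of smaller weight. Sending [g]
    to its linear part [(l_1, ..., l_n)] is a homomorphism onto [L_alpha],
    split by the inclusion of [L_alpha], and its kernel is [M_alpha]. Elements
    of [M_alpha] are tame since they are triangular. *)

Require Import Defs.
From mathcomp Require Import all_boot all_order all_algebra.
From mathcomp Require Import reals.
From mathcomp Require Import fingroup perm boolp classical_sets mpoly.
From mathcomp Require Import -(notations) constructive_ereal.

Set Implicit Arguments.
Unset Strict Implicit.
Unset Printing Implicit Defensive.

Import Order.TTheory GRing.Theory Num.Theory.

(** * Supports of substituted polynomials and dependence on variables *)

Section Monomials.
Local Open Scope ring_scope.
Context {k : fieldType} {n : nat}.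
Implicit Types (P Q : {mpoly k[n]}) (h : n.-tuple {mpoly k[n]}) (m : 'X_{1..n}).

Lemma msupp_XU (i : 'I_n) m : m \in msupp ('X_i : {mpoly k[n]}) -> m = U_(i)%MM.
Proof. by move/mem_msuppXP. Qed.

(* [T m m'] reads: the monomial [m'] may occur in the substitution of [h] in
   the monomial [m]. *)
Lemma msupp_comp (T : 'X_{1..n} -> 'X_{1..n} -> Prop) P h :
    T 0%MM 0%MM ->
    (forall m1 m2 m1' m2',
      T m1 m1' -> T m2 m2' -> T (m1 + m2)%MM (m1' + m2')%MM) ->
    (forall m i, m \in msupp P -> m i != 0%N ->
      forall m', m' \in msupp (tnth h i) -> T U_(i)%MM m') ->
  forall m', m' \in msupp (P \mPo h) -> exists2 m, m \in msupp P & T m m'.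
Proof.
move=> T0 TD TX m'; rewrite comp_mpolyEX.
have mulT m1 m2 Q1 Q2 : (forall x, x \in msupp Q1 -> T m1 x) ->
    (forall x, x \in msupp Q2 -> T m2 x) ->
    forall x, x \in msupp (Q1 * Q2) -> T (m1 + m2)%MM x.
  move=> T1 T2 x /msuppM_le /allpairsP[[y z] /= [yQ zQ ->]].
  by apply: TD; [exact: T1|exact: T2].
have oneT x : x \in msupp (1 : {mpoly k[n]}) -> T 0%MM x.
  by rewrite msupp1 inE => /eqP->.
move=> /msupp_sum_le /flattenP[s /mapP[m]]; rewrite filter_predT => mP ->.
move=> /msuppZ_le; rewrite comp_mpolyX => m'P; exists m => //.
(* Writing [m] as a sum of multiples of unit monomials matches the product of powers of the
   components of [h], so additivity of [T] reduces the claim to single variables. *)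
rewrite [m in T m]multinomUE_id; move: m' m'P.
elim/big_ind2: _ => [||i _]; [exact: oneT|by move=> m1 Q1 m2 Q2; exact: mulT|].
have [->|mi] := eqVneq (m i) 0%N; first by rewrite expr0 mulm0n.
elim: (m i) => [|d IHd]; first by rewrite expr0 mulm0n.
by rewrite exprS mulmS; apply: mulT => //; exact: TX mP mi.
Qed.

Lemma depends_comp (S S' : pred 'I_n) P h : depends_only_on S P ->
  (forall i, S i -> depends_only_on S' (tnth h i)) ->
  depends_only_on S' (P \mPo h).
Proof.
move=> SP Sh m' m'P.
(* The source monomial is ignored: only the variables occurring in the result matter. *)
pose T (_ x : 'X_{1..n}) := forall j, x j != 0%N -> S' j.
suff [m _ //] : exists2 m, m \in msupp P & T m m'.
apply: msupp_comp m'P => [j|m1 m2 m1' m2' T1 T2 j|m i mP mi x xh].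
- by rewrite mnm0E.
- by rewrite mnmDE addn_eq0 negb_and => /orP[]; [exact: T1|exact: T2].
- by apply: (Sh i) => //; exact: SP mP _ mi.
Qed.

Lemma comp_mpoly_agree (S : pred 'I_n) P h h' : depends_only_on S P ->
  (forall i, S i -> tnth h i = tnth h' i) -> P \mPo h = P \mPo h'.
Proof.
move=> SP hh'; rewrite !comp_mpolyE; apply: eq_big_seq => m mP.
congr (_ *: _); apply: eq_bigr => i _.
have [->|mi] := eqVneq (m i) 0%N; first by rewrite !expr0.
by rewrite hh' //; exact: SP mP _ mi.
Qed.

Lemma depends_id S P h : depends_only_on S P ->
  (forall i, S i -> tnth h i = 'X_i) -> P \mPo h = P.
Proof.
move=> SP hX; rewrite -[RHS]comp_mpoly_id; apply: comp_mpoly_agree SP _ => i Si.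
by rewrite hX // tnth_mktuple.
Qed.

Lemma dependsX (S : pred 'I_n) (i : 'I_n) : S i ->
  depends_only_on S ('X_i : {mpoly k[n]}).
Proof.
by move=> Si m /msupp_XU -> j; rewrite mnm1E eqb0 negbK => /eqP <-.
Qed.

Lemma dependsN (S : pred 'I_n) P : depends_only_on S P -> depends_only_on S (- P).
Proof. by move=> SP m; rewrite (perm_mem (msuppN P)); exact: SP. Qed.

Lemma depends_sub (S S' : pred 'I_n) P : (forall i, S i -> S' i) ->
  depends_only_on S P -> depends_only_on S' P.
Proof. by move=> SS' SP m mP j mj; apply/SS'/(SP m). Qed.

Lemma depends_none (S : pred 'I_n) P : S =1 xpred0 -> depends_only_on S P ->
  P = (P@_0%MM)%:MP.
Proof.
move=> S0 SP; apply/mpolyP => m; rewrite mcoeffC.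
have [->|m0] := eqVneq m 0%MM; first by rewrite mulr1.
rewrite mulr0; apply: memN_msupp_eq0; apply: contra_neqN m0 => mP.
apply/mnmP => j; rewrite mnm0E; apply/eqP/negPn/negP => mj.
by have := SP m mP j mj; rewrite S0.
Qed.

End Monomials.

(** * Pullbacks, linear automorphisms and tameness *)

Section Automorphisms.
Local Open Scope ring_scope.
Context {k : fieldType} {n : nat}.
Local Notation poly := {mpoly k[n]}.
Implicit Types (f g h : polyaut k n) (P Q : poly).

Lemma polyaut_ext g h : (forall i, polyaut_comp g i = polyaut_comp h i) -> g = h.
Proof. by move=> gh; apply: polyaut_map_inj; exact: eq_from_tnth. Qed.

Lemma polyaut_compM g h i :
  polyaut_comp (g * h)%g i = pullback h (polyaut_comp g i).
Proof. exact: tnth_mktuple. Qed.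

Lemma polyaut_comp1 i : polyaut_comp (1%g : polyaut k n) i = 'X_i.
Proof. exact: tnth_mktuple. Qed.

Lemma pullbackM g h P : pullback (g * h)%g P = pullback h (pullback g P).
Proof. exact: pmap_compE. Qed.

Lemma pullback1 P : pullback (1%g : polyaut k n) P = P.
Proof. exact: comp_mpoly_id. Qed.

Lemma pullbackK g P : pullback g (pullback (g^-1)%g P) = P.
Proof. by rewrite -pullbackM mulVg pullback1. Qed.

Lemma pullbackX g i : pullback g 'X_i = polyaut_comp g i.
Proof. by rewrite /pullback comp_mpolyXU /polyaut_comp (tnth_nth 0). Qed.

Definition lin_map (A : 'M[k]_n) : n.-tuple poly :=
  [tuple \sum_j A i j *: 'X_j | i < n].

(** With components read off the rows, composition and matrix product come in the same order. *)
Lemma lin_map_comp A B : pmap_comp (lin_map A) (lin_map B) = lin_map (A *m B).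
Proof.
apply: eq_from_tnth => i; rewrite !tnth_mktuple raddf_sum /=.
under eq_bigr do rewrite comp_mpolyZ comp_mpolyXU -tnth_nth tnth_mktuple scaler_sumr.
rewrite exchange_big /=; apply: eq_bigr => j _.
by rewrite mxE scaler_suml; apply: eq_bigr => l _; rewrite scalerA.
Qed.

Lemma lin_map1 : lin_map 1%:M = pmap_id.
Proof.
apply: eq_from_tnth => i; rewrite !tnth_mktuple (bigD1 i) //= big1 => [|j ji].
  by rewrite mxE eqxx scale1r addr0.
by rewrite mxE eq_sym (negPf ji) scale0r.
Qed.

Lemma lin_aut_subproof (A : 'M[k]_n) (A_unit : A \in unitmx) :
  inverse_pmaps (lin_map A, lin_map (invmx A)).
Proof. by rewrite /inverse_pmaps !lin_map_comp mulmxV ?mulVmx // lin_map1 !eqxx. Qed.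

Definition lin_aut A A_unit : polyaut k n := PolyAut (@lin_aut_subproof A A_unit).

Lemma lin_autP A A_unit : is_linear_of A (@lin_aut A A_unit).
Proof. by move=> i; exact: tnth_mktuple. Qed.

Lemma linear_of_map A g : is_linear_of A g -> polyaut_map g = lin_map A.
Proof. by move=> gA; apply: eq_from_tnth => i; rewrite tnth_mktuple -gA. Qed.

Lemma linear_of1 : is_linear_of 1%:M (1%g : polyaut k n).
Proof. by move=> i; rewrite /polyaut_comp /polyaut_map /= -lin_map1 tnth_mktuple. Qed.

Lemma linear_ofM A B g h : is_linear_of A g -> is_linear_of B h ->
  is_linear_of (A *m B) (g * h)%g.
Proof.
move=> /linear_of_map gA /linear_of_map hB i.
have -> : polyaut_comp (g * h)%g i = tnth (pmap_comp (polyaut_map g) (polyaut_map h)) i.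
  by [].
by rewrite gA hB lin_map_comp tnth_mktuple.
Qed.

Lemma linear_ofV A g : A \in unitmx -> is_linear_of A g ->
  is_linear_of (invmx A) (g^-1)%g.
Proof.
move=> uA gA; have -> : g = lin_aut uA.
  by apply: polyaut_ext => i; rewrite gA (lin_autP uA).
by move=> i; exact: tnth_mktuple.
Qed.

Lemma is_subgroup_Tame : is_subgroup (@Tame k n).
Proof. exact: subgroup_generated_group. Qed.

Lemma Tame1 : Tame (1%g : polyaut k n).
Proof. by apply: set_mem; case: is_subgroup_Tame. Qed.

Lemma TameM g h : Tame g -> Tame h -> Tame (g * h)%g.
Proof.
move=> Tg Th; apply: set_mem.
by apply: (group_closedM is_subgroup_Tame); apply: mem_set.
Qed.

Lemma TameV g : Tame g -> Tame (g^-1)%g.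
Proof.
move=> Tg; apply: set_mem.
by apply: (group_closedV is_subgroup_Tame); apply: mem_set.
Qed.

Lemma Tame_GL g : GL_aut g -> Tame g.
Proof. by move=> gGL H [_]; apply; left. Qed.

Lemma Tame_elementary g : elementary_aut g -> Tame g.
Proof. by move=> gE H [_]; apply; right. Qed.

(** * Tameness of one-variable shifts and of triangular automorphisms *)

Definition shift_map (i : 'I_n) P : n.-tuple poly :=
  [tuple if j == i then 'X_j + P else 'X_j | j < n].

(** Since [P] does not involve the shifted variable, substitution leaves it unchanged and the two
    shifts cancel. *)
Lemma shift_mapK i P : depends_only_on (predC1 i) P ->
  pmap_comp (shift_map i P) (shift_map i (- P)) = pmap_id.
Proof.
move=> iP; apply: eq_from_tnth => j; rewrite !tnth_mktuple.
have [->|ji] := eqVneq j i; last first.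
  by rewrite comp_mpolyXU -tnth_nth tnth_mktuple (negPf ji).
rewrite comp_mpolyD comp_mpolyXU -tnth_nth tnth_mktuple eqxx.
rewrite (@depends_id _ _ _ _ _ iP) ?subrK // => l /= /negPf li.
by rewrite tnth_mktuple li.
Qed.

Lemma shift_aut_subproof i P : depends_only_on (predC1 i) P ->
  inverse_pmaps (shift_map i P, shift_map i (- P)).
Proof.
move=> iP; rewrite /inverse_pmaps /= shift_mapK // eqxx.
by rewrite -[P in pmap_comp _ (shift_map i P)]opprK shift_mapK ?eqxx //; exact: dependsN.
Qed.

Definition shift_aut i P iP : polyaut k n := PolyAut (@shift_aut_subproof i P iP).

Lemma shift_autE i P iP j :
  polyaut_comp (@shift_aut i P iP) j = if j == i then 'X_j + P else 'X_j.
Proof. exact: tnth_mktuple. Qed.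

Lemma perm_linear (s : 'S_n) A_unit i :
  polyaut_comp (@lin_aut (perm_mx s) A_unit) i = 'X_(s i).
Proof.
rewrite lin_autP (bigD1 (s i)) //= big1 => [|j jsi].
  by rewrite !mxE eqxx scale1r addr0.
by rewrite !mxE eq_sym (negPf jsi) scale0r.
Qed.

(* Conjugation by a transposition moves the distinguished variable to index 0. *)
Lemma Tame_shift i P iP : Tame (@shift_aut i P iP).
Proof.
have n_gt0 : (0 < n)%N := leq_ltn_trans (leq0n i) (ltn_ord i).
pose i0 := Ordinal n_gt0; pose s := tperm i0 i.
have uA : perm_mx s \in (unitmx : pred 'M[k]_n) by exact: unitmx_perm.
pose t := lin_aut uA.
have tE j : polyaut_comp t j = 'X_(s j) by exact: perm_linear.
have Tt : Tame t by apply: Tame_GL; exists (perm_mx s) => //; exact: lin_autP.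
have tt : (t * t)%g = 1%g.
  apply: polyaut_ext => j; rewrite polyaut_compM tE pullbackX tE tpermK.
  by rewrite polyaut_comp1.
(* [P] avoids variable [i], which [t] exchanges with variable [i0]. *)
have iP' : depends_only_on (predC1 i0) (pullback t P).
  apply: depends_comp iP _ => j /= ji; rewrite -/(polyaut_comp t j) tE.
  apply: dependsX => /=; apply: contra_neq ji => sj.
  by rewrite -[j](tpermK i0 i) -/s sj tpermL.
have Te : Tame (shift_aut iP').
  apply: Tame_elementary; exists (pullback t P) => [|j].
    by apply: depends_sub iP' => j /=.
  by rewrite shift_autE -val_eqE.
suff -> : shift_aut iP = (t * shift_aut iP' * t)%g by do !apply: TameM => //.
apply: polyaut_ext => j; rewrite !polyaut_compM tE pullbackX !shift_autE.
have -> : (s j == i0) = (j == i).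
  by rewrite (can2_eq (tpermK i0 i) (tpermK i0 i)) tpermL.
case: eqP => _; last by rewrite pullbackX tE tpermK.
rewrite /pullback comp_mpolyD -!/(pullback t _) pullbackX tE tpermK.
by rewrite -pullbackM tt pullback1.
Qed.

(** The shifts are removed one component at a time, from index 0 upwards; the induction is on the
    number [d] of final components that may still differ from the identity. *)
Lemma Tame_triangular g (P : 'I_n -> poly) :
    (forall i, polyaut_comp g i = 'X_i + P i) ->
    (forall i : 'I_n, depends_only_on (fun j => (i < j)%N) (P i)) ->
  Tame g.
Proof.
move=> gE Plt.
suff H d f (Q : 'I_n -> poly) : (d <= n)%N ->
    (forall i, polyaut_comp f i = 'X_i + Q i) ->
    (forall i : 'I_n, depends_only_on (fun j => (i < j)%N) (Q i)) ->
    (forall i : 'I_n, (i < n - d)%N -> Q i = 0) -> Tame f.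
  by apply: (H n g P) => // i; rewrite subnn.
elim: d f Q => [|d IHd] f Q dn fE Qlt Q0.
  suff -> : f = 1%g by exact: Tame1.
  by apply: polyaut_ext => i; rewrite fE Q0 ?addr0 ?polyaut_comp1 ?subn0.
have ltn : (n - d.+1 < n)%N by rewrite ltn_subrL /= (leq_trans _ dn).
pose i := Ordinal ltn.
(* Composing with the shift by [- Q i] cancels component [i]. Later components are unaffected,
   because their [Q] only involves variables after [i], which this shift fixes. *)
have iQ : depends_only_on (predC1 i) (- Q i).
  apply/dependsN/depends_sub/(Qlt i) => j /=.
  by apply: contraTneq => ->; rewrite ltnn.
have eX (j : 'I_n) : (i < j)%N -> tnth (polyaut_map (shift_aut iQ)) j = 'X_j.
  move=> ij; rewrite -/(polyaut_comp _ j) shift_autE ifN //.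
  by apply: contraTneq ij => ->; rewrite ltnn.
suff Tfe : Tame (f * shift_aut iQ)%g.
  rewrite -[f](mulgK (shift_aut iQ)); apply: TameM Tfe _.
  by apply: TameV; exact: Tame_shift.
pose Q' j := if j == i then 0 else Q j.
apply: (IHd _ Q'); first exact: ltnW.
- move=> j; rewrite polyaut_compM fE /Q' /pullback comp_mpolyD.
  rewrite -/(pullback _ 'X_j) pullbackX shift_autE.
  have [->|ji] := eqVneq j i.
    by rewrite (depends_id (Qlt i)) // subrK addr0.
  have [jlt|jge] := ltnP j (n - d.+1); first by rewrite (Q0 j) // comp_mpoly0.
  congr (_ + _); apply: depends_id (Qlt j) _ => l /= jl; apply: eX.
  exact: leq_ltn_trans jge jl.
- move=> j; rewrite /Q'; case: eqP => // _ m; by rewrite msupp0.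
- move=> j jlt; rewrite /Q'; case: eqP => // /eqP ji; apply: Q0.
  move: ji; rewrite -val_eqE /= => ji; rewrite ltn_neqAle ji /=.
  by rewrite -ltnS -subSn // subSS.
Qed.

End Automorphisms.

(** * Weights of monomials and the degree filtration *)

Section Weights.
Local Open Scope ring_scope.
Context {R : realType} {k : fieldType} {n : nat} (a : 'I_n -> R).
Context (a_gt0 : Pi a).
Local Notation poly := {mpoly k[n]}.
Implicit Types (g h : polyaut k n) (P Q : poly) (m : 'X_{1..n}) (t c : R) (A : 'M[k]_n).

Definition wt m : R := \sum_i a i * (m i)%:R.

Lemma wtD m1 m2 : wt (m1 + m2)%MM = wt m1 + wt m2.
Proof.
by rewrite -big_split; apply: eq_bigr => i _; rewrite mnmDE natrD mulrDr.
Qed.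

Lemma wt0 : wt 0%MM = 0.
Proof. by apply: big1 => i _; rewrite mnm0E mulr0. Qed.

Lemma wtU i : wt U_(i)%MM = a i.
Proof.
rewrite /wt (bigD1 i) //= big1 => [|j ji]; first by rewrite mnm1E eqxx mulr1 addr0.
by rewrite mnm1E eq_sym (negPf ji) mulr0.
Qed.

Lemma wt_ge0 m : 0 <= wt m.
Proof. by apply: sumr_ge0 => i _; rewrite mulr_ge0 ?ler0n ?ltW. Qed.

Lemma mnm_subU m i : m i != 0%N -> (m - U_(i) + U_(i))%MM = m.
Proof.
move=> mi; apply: submK; apply/mnm_lepP => j; rewrite mnm1E.
by case: eqP => // <-; rewrite lt0n.
Qed.

Lemma wt_ge m i : m i != 0%N -> a i <= wt m.
Proof. by move=> mi; rewrite -(mnm_subU mi) wtD wtU lerDr wt_ge0. Qed.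

Lemma wt_le0 m : wt m <= 0 -> m = 0%MM.
Proof.
move=> m0; apply/mnmP => i; rewrite mnm0E; apply/eqP; apply: contraTT m0 => mi.
by rewrite -ltNge (lt_le_trans (a_gt0 i)) ?wt_ge.
Qed.

(** Once one factor of variable [i] is removed, the remaining weight is at most 0, and positivity of
    all weights leaves only the trivial monomial. *)
Lemma wt_leU m i : m i != 0%N -> wt m <= a i -> m = U_(i)%MM.
Proof.
move=> mi; rewrite -(mnm_subU mi) wtD wtU -[leRHS]add0r lerD2r.
by move=> /wt_le0 ->; rewrite add0m.
Qed.

(** Steps of the filtration replace values of [nu_id]: the zero polynomial lies in every step, so
    infinite values need no separate treatment. *)
Definition deg_le t P : Prop := forall m, m \in msupp P -> wt m <= t.

Lemma deg_leX i : deg_le (a i) ('X_i : poly).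
Proof. by move=> m /msupp_XU ->; rewrite wtU. Qed.

Lemma deg_leB t P Q : deg_le t P -> deg_le t Q -> deg_le t (P - Q).
Proof.
move=> tP tQ m /msuppB_le; rewrite mem_cat.
by case/orP; [exact: tP|exact: tQ].
Qed.

Lemma deg_leD t P Q : deg_le t P -> deg_le t Q -> deg_le t (P + Q).
Proof.
move=> tP tQ m /msuppD_le; rewrite mem_cat.
by case/orP; [exact: tP|exact: tQ].
Qed.

Lemma deg_leZ t (x : k) P : deg_le t P -> deg_le t (x *: P).
Proof. by move=> tP m /msuppZ_le; exact: tP. Qed.

Lemma deg_le0 t : deg_le t (0 : poly).
Proof. by move=> m; rewrite msupp0. Qed.

Lemma deg_le_sum t (S : pred 'I_n) (F : 'I_n -> poly) :
  (forall i, S i -> deg_le t (F i)) -> deg_le t (\sum_(i | S i) F i).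
Proof.
move=> SF; elim/big_ind: _ => //; [exact: deg_le0|exact: deg_leD].
Qed.

(** The bound on [h] is asked only for the variables in [S], so that it can be used in an induction
    where only some components are controlled so far. *)
Lemma deg_le_comp (S : pred 'I_n) t P (h : n.-tuple poly) :
  depends_only_on S P -> (forall i, S i -> deg_le (a i) (tnth h i)) ->
  deg_le t P -> deg_le t (P \mPo h).
Proof.
move=> SP Sh tP m' m'P.
suff [m mP m'm] : exists2 m, m \in msupp P & wt m' <= wt m.
  by apply: le_trans m'm _; exact: tP.
pose T m x := wt x <= wt m; rewrite -/(T _ _).
apply: (@msupp_comp _ _ T) m'P => [|m1 m2 m1' m2' T1 T2|m i mP mi x xh].
- exact: lexx.
- by rewrite /T !wtD lerD.
- by rewrite /T wtU; apply: (Sh i) => //; exact: SP mP _ mi.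
Qed.

Lemma nu_id_ge t P : (EFin (- t) <= nu_id a P)%O <-> deg_le t P.
Proof.
split=> [tP m mP|tP].
  suff : (EFin (- t) <= EFin (- wt m))%O by rewrite lee_fin lerN2.
  apply: le_trans tP _; rewrite /nu_id (big_rem m) //=.
  by rewrite ge_min lexx.
rewrite /nu_id big_seq; apply: le_bigmin; first exact: leey.
by move=> m mP; rewrite lee_fin lerN2; exact: tP.
Qed.

(** The filtration determines the valuation: a finite value of [P] is itself a filtration level that
    passes to [Q]. *)
Lemma nu_id_le P Q : (forall t, deg_le t P -> deg_le t Q) ->
  (nu_id a P <= nu_id a Q)%O.
Proof.
move=> PQ; case E : (nu_id a P) => [r| |]; last exact: leNye.
  by rewrite -[r]opprK; apply/nu_id_ge/PQ/nu_id_ge; rewrite opprK E.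
(* Here [P] lies in every step, hence so does [Q]; a monomial [m] of [Q] would then have weight at
   most [wt m - 1]. *)
suff -> : Q = 0 by rewrite /nu_id msupp0 big_nil.
apply: msuppnil0; case Qs : (msupp Q) => [//|m s].
have mQ : m \in msupp Q by rewrite Qs mem_head.
have := PQ (wt m - 1) _ m mQ; rewrite lerBrDr gerDl => H.
by have := ler10 R; rewrite H //; apply/nu_id_ge; rewrite E leey.
Qed.

Lemma oppe_nu_id_le t P : (oppe (nu_id a P) <= EFin t)%O <-> deg_le t P.
Proof.
rewrite -nu_id_ge; case: (nu_id a P) => [r| |] //=.
  by rewrite !lee_fin lerNl.
by rewrite leey leNye.
Qed.

(** * Automorphisms preserving the filtration, and the stabilizer *)

Definition isometry g : Prop := forall t P, deg_le t (pullback g P) <-> deg_le t P.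

Definition filtered g : Prop := forall i, deg_le (a i) (polyaut_comp g i).

Lemma filtered_pullback g : filtered g ->
  forall t P, deg_le t P -> deg_le t (pullback g P).
Proof. by move=> gF t P; apply: (@deg_le_comp predT) => // m _. Qed.

Lemma isometryP g : isometry g <-> filtered g /\ filtered (g^-1)%g.
Proof.
split=> [gI|[gF gVF] t P].
  split=> i; rewrite -pullbackX; first by apply: (gI _ _).2; exact: deg_leX.
  by apply: (gI _ _).1; rewrite pullbackK; exact: deg_leX.
split; last exact: filtered_pullback.
by move=> /(filtered_pullback gVF); rewrite -pullbackM mulgV pullback1.
Qed.

Lemma isometryM g h : isometry g -> isometry h -> isometry (g * h)%g.
Proof. by move=> gI hI t P; rewrite pullbackM hI gI. Qed.

Lemma isometryV g : isometry g -> isometry (g^-1)%g.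
Proof. by move=> /isometryP[? ?]; apply/isometryP; rewrite invgK. Qed.

Lemma isometry1 : isometry 1%g.
Proof. by move=> t P; rewrite pullback1. Qed.

(* If [g] scaled degrees by [c < 1], then the image of a variable of least
   weight would have degree less than any variable, and so be constant. *)
Lemma scaling_ge1 (i : 'I_n) c g : (forall j, a i <= a j) ->
    (forall t P, deg_le (c * t) (pullback g P) <-> deg_le t P) ->
  1 <= c.
Proof.
move=> imin gc; rewrite leNgt; apply/negP => c1.
have gi : deg_le (c * a i) (pullback g 'X_i) by apply/gc; exact: deg_leX.
have : deg_le (c * 0) (pullback g 'X_i).
  rewrite mulr0 => m /gi mi; suff -> : m = 0%MM by rewrite wt0.
  apply/mnmP => j; rewrite mnm0E; apply/eqP; apply: contraTT mi => mj.
  rewrite -ltNge (lt_le_trans _ (wt_ge mj)) // (lt_le_trans _ (imin j)) //.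
  by rewrite gtr_pMl.
move=> /gc /(_ U_(i)%MM); rewrite wtU msuppX mem_head => /(_ isT).
by rewrite leNgt a_gt0.
Qed.

Lemma tame_stabP (i : 'I_n) g : (forall j, a i <= a j) ->
  tame_stab (nu_id_class k a_gt0) g <-> Tame g /\ isometry g.
Proof.
move=> imin; split=> [[Tg /(congr1 val) /=]|[Tg gI]]; last first.
  exists Tg; apply: val_inj; rewrite /= act_class_vclass; apply/esym/vclassP.
  exists 1 => // P; rewrite mul1e; apply: le_anti; rewrite /act.
  by rewrite !nu_id_le // => t; apply gI.
rewrite act_class_vclass => /esym/vclassP[c c_gt0 gc]; split=> //.
have gc' t P : deg_le (c * t) (pullback g P) <-> deg_le t P.
  rewrite -!nu_id_ge; have := gc P; rewrite /act => ->.
  by rewrite -mulrN EFinM lee_pmul2l.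
have c_ge1 := scaling_ge1 imin gc'.
(* The inverse of [g] scales degrees by [c^-1], so the same bound applied to it gives [c <= 1]. *)
suff c1 : c = 1 by move=> t P; have := gc' t P; rewrite c1 mul1r.
apply: le_anti; rewrite c_ge1 andbT -[c]invrK invf_le1 ?invr_gt0 //.
apply: (@scaling_ge1 i _ (g^-1)%g imin) => t P.
by have := gc' (c^-1 * t) (pullback g^-1%g P); rewrite pullbackK mulVKf ?gt_eqF // => ->.
Qed.

(** * The block diagonal linear part of a filtered automorphism *)

Definition lin_part g : 'M[k]_n :=
  \matrix_(i, j) if a i == a j then (polyaut_comp g i)@_U_(j) else 0.

Lemma depends_lower i P : deg_le (a i) P ->
    (forall j, a i = a j -> P@_U_(j) = 0) ->
  depends_only_on (fun j => a j < a i) P.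
Proof.
move=> iP P0 m mP j mj; have mi := iP _ mP.
rewrite lt_neqAle (le_trans (wt_ge mj) mi) andbT.
apply: contraTneq mP => ji; rewrite mcoeff_msupp negbK.
have -> : m = U_(j)%MM by apply: wt_leU mj _; rewrite ji.
by rewrite P0.
Qed.

Lemma lower_coef0 i j P : depends_only_on (fun j => a j < a i) P -> a i = a j ->
  P@_U_(j) = 0.
Proof.
move=> iP ij; apply: memN_msupp_eq0; apply/negP => /iP /(_ j).
by rewrite mnm1E eqxx ij ltxx => /(_ isT).
Qed.

Lemma filtered_lower g i P : filtered g ->
    depends_only_on (fun j => a j < a i) P ->
  depends_only_on (fun j => a j < a i) (pullback g P).
Proof.
move=> gF iP; apply: depends_comp iP _ => j ji m mg l ml.
by apply: le_lt_trans ji; apply: le_trans (wt_ge ml) (gF _ _ mg).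
Qed.

(** Linear terms in variables of smaller weight are left in [Q]: [lin_part] keeps only those of
    weight exactly [a i], and subtracting them leaves a polynomial to which [depends_lower]
    applies. *)
Lemma filtered_decomp g i : filtered g ->
  exists2 Q, polyaut_comp g i = \sum_j lin_part g i j *: 'X_j + Q &
    depends_only_on (fun j => a j < a i) Q.
Proof.
move=> gF; pose L : poly := \sum_j lin_part g i j *: 'X_j.
exists (polyaut_comp g i - L); first by rewrite addrC subrK.
apply: depends_lower => [|j ij].
  apply: deg_leB => //; apply: deg_le_sum => j _; rewrite mxE.
  case: eqP => [->|_]; first by apply: deg_leZ; exact: deg_leX.
  by rewrite scale0r; exact: deg_le0.
rewrite mcoeffB raddf_sum /= (bigD1 j) //= big1 => [|l lj].
  by rewrite mcoeffZ mcoeffXU eqxx mulr1 mxE ij eqxx addr0 subrr.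
by rewrite mcoeffZ mcoeffXU (negPf lj) mulr0.
Qed.

(** The remainder of a component of [g] still involves only variables of smaller weight after
    pullback by [h], so it does not contribute to the linear part. *)
Lemma lin_partM g h : filtered g -> filtered h ->
  lin_part (g * h)%g = lin_part g *m lin_part h.
Proof.
move=> gF hF; apply/matrixP => i j; rewrite !mxE.
have [Q gE iQ] := filtered_decomp i gF; case: eqP => [ij|/eqP ij]; last first.
  rewrite big1 // => l _; rewrite !mxE; case: eqP => [il|_]; last by rewrite mul0r.
  by rewrite -il (negPf ij) mulr0.
rewrite polyaut_compM gE /pullback raddfD raddf_sum /= mcoeffD raddf_sum /=.
rewrite (lower_coef0 (filtered_lower hF iQ) ij) addr0; apply: eq_bigr => l _.
rewrite comp_mpolyZ mcoeffZ -/(pullback h 'X_l) pullbackX.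
rewrite !mxE; case: eqP => [il|_]; last by rewrite !mul0r.
by rewrite -il ij eqxx.
Qed.

Lemma lin_part1 : lin_part 1%g = 1%:M.
Proof.
apply/matrixP => i j; rewrite !mxE polyaut_comp1 mcoeffXU.
by have [->|_] := eqVneq i j; rewrite ?eqxx ?if_same.
Qed.

Lemma lin_part_unit g : isometry g -> lin_part g \in unitmx.
Proof.
move=> /isometryP[gF gVF]; suff /mulmx1_unit[] : lin_part g *m lin_part g^-1%g = 1%:M by [].
by rewrite -lin_partM // mulgV lin_part1.
Qed.

Lemma lin_part_linear A g : (forall i j, a i != a j -> A i j = 0) ->
  is_linear_of A g -> lin_part g = A.
Proof.
move=> A0 gA; apply/matrixP => i j; rewrite mxE gA.
case: eqP => [_|/eqP/A0->//]; rewrite raddf_sum /= (bigD1 j) //= big1 => [|l lj].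
  by rewrite mcoeffZ mcoeffXU eqxx mulr1 addr0.
by rewrite mcoeffZ mcoeffXU (negPf lj) mulr0.
Qed.

Lemma linear_filtered A g : (forall i j, a i != a j -> A i j = 0) ->
  is_linear_of A g -> filtered g.
Proof.
move=> A0 gA i; rewrite gA; apply: deg_le_sum => j _.
have [->|/A0->] := eqVneq (a i) (a j); first by apply: deg_leZ; exact: deg_leX.
by rewrite scale0r; exact: deg_le0.
Qed.

(* A matrix is block diagonal iff it commutes with the projectors onto the
   blocks, a condition that passes to the inverse. *)
Lemma invmx_block (A : 'M[k]_n) : A \in unitmx ->
    (forall i j, a i != a j -> A i j = 0) ->
  forall i j, a i != a j -> invmx A i j = 0.
Proof.
move=> uA A0 i j ij.
pose D : 'M[k]_n := diag_mx (\row_l (a l == a j)%:R).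
have AD : A *m D = D *m A.
  apply/matrixP => x y; rewrite mul_mx_diag mul_diag_mx !mxE.
  have [->|/A0->] := eqVneq (a x) (a y); first by rewrite mulrC.
  by rewrite mulr0 mul0r.
have : invmx A *m D = D *m invmx A.
  by rewrite -[D in LHS](mulmxK uA) -AD -!mulmxA (mulKmx uA).
move=> /matrixP/(_ i j); rewrite mul_mx_diag mul_diag_mx !mxE eqxx mulr1.
by rewrite (negPf ij) mul0r.
Qed.

Lemma linear_isometry A g : A \in unitmx ->
    (forall i j, a i != a j -> A i j = 0) ->
  is_linear_of A g -> isometry g.
Proof.
move=> uA A0 gA; apply/isometryP; split; first exact: linear_filtered A0 gA.
exact: linear_filtered (invmx_block uA A0) (linear_ofV uA gA).
Qed.

(** * The groups L and M described by weights and linear parts *)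

Context (a_noninc : forall i j : 'I_n, (i <= j)%N -> a j <= a i).

(** The list of weights is nonincreasing, being a subsequence of the values of [a], so a later
    position means a smaller weight. *)
Lemma block_lt i j : (block a i < block a j)%N = (a j < a i).
Proof.
have in_weights l : a l \in weights a by rewrite /weights mem_undup codom_f.
have ge_tr : transitive (>=%R : rel R) by move=> x y z xy /le_trans; apply.
have weights_sorted : sorted (>=%R : rel R) (weights a).
  apply: (subseq_sorted ge_tr (undup_subseq _)).
  rewrite sorted_map; apply: (@sub_sorted _ (relpre val ltn)) => [x y /= xy|].
    by rewrite a_noninc // ltnW.
  by rewrite -sorted_map val_enum_ord iota_ltn_sorted.
have le_block x y : (block a x < block a y)%N -> a y <= a x.
  exact: (sorted_ltn_index ge_tr weights_sorted).
apply/idP/idP => [ij|ji].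
  rewrite lt_neqAle le_block // andbT.
  by apply: contraTneq ij => ji; rewrite /block ji ltnn.
rewrite ltn_neqAle; apply/andP; split.
  apply: contraTneq ji => /(index_inj (a i)) -> //; by rewrite ltxx.
by rewrite leqNgt; apply: contraTN ji => /le_block; rewrite -leNgt.
Qed.

Lemma block_eq i j : (block a i == block a j) = (a i == a j).
Proof.
apply/eqP/eqP => [ij|ij]; last by rewrite /block ij.
by apply: le_anti; rewrite leNgt -block_lt ij ltnn leNgt -block_lt ij ltnn.
Qed.

Lemma L_P g : L_ k a g <-> exists A, [/\ A \in unitmx,
  forall i j, a i != a j -> A i j = 0 & is_linear_of A g].
Proof.
by split=> -[A [uA A0 gA]]; exists A; split=> // i j ij; apply: A0;
  rewrite ?block_eq // -block_eq.
Qed.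

Lemma L_subgroup : is_subgroup (L_ k a).
Proof.
split=> [|g h /set_mem/L_P[A [uA A0 gA]] /set_mem/L_P[B [uB B0 hB]]].
  apply/mem_set/L_P; exists 1%:M; split; [exact: unitmx1| |exact: linear_of1].
  by move=> i j; rewrite mxE; have [->|] := eqVneq i j; rewrite ?eqxx.
(* Closure is tested on quotients, hence the inverse of [B]. *)
apply/mem_set/L_P; exists (A *m invmx B).
split; first by rewrite unitmx_mul uA unitmx_inv.
  move=> i j ij; rewrite mxE big1 // => l _.
  have [il|/A0->] := eqVneq (a i) (a l); last by rewrite mul0r.
  by rewrite (invmx_block uB B0) ?mulr0 -?il.
exact: linear_ofM gA (linear_ofV uB hB).
Qed.

(* The components of the inverse are found successively, from the last one up:
   [h_i = x_i - P_i(h)] and [P_i] only involves later variables. *)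
Lemma M_filteredV g (P : 'I_n -> poly) : (forall i, deg_le (a i) (P i)) ->
    (forall i, depends_only_on (fun j => a j < a i) (P i)) ->
    (forall i, polyaut_comp g i = 'X_i + P i) ->
  filtered (g^-1)%g.
Proof.
move=> degP lowP gE.
have hE i : polyaut_comp (g^-1)%g i = 'X_i - pullback (g^-1)%g (P i).
  have := polyaut_compM g (g^-1)%g i; rewrite mulgV polyaut_comp1 gE.
  by rewrite /pullback comp_mpolyD -/(pullback _ 'X_i) pullbackX => ->; rewrite addrK.
suff H d (i : 'I_n) : (n - i <= d)%N -> deg_le (a i) (polyaut_comp (g^-1)%g i).
  by move=> i; exact: (H (n - i)%N).
elim: d i => [|d IHd] i nid.
  by move: nid; rewrite leqn0 subn_eq0 leqNgt ltn_ord.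
rewrite hE; apply: deg_leB; first exact: deg_leX.
apply: deg_le_comp (lowP i) _ (degP i) => j ji; apply: IHd.
have ij : (i < j)%N.
  by rewrite ltnNge; apply: contraTN ji => /a_noninc; rewrite -leNgt.
by rewrite -ltnS (leq_trans _ nid) // ltn_sub2l // ltn_ord.
Qed.

(** Given the filtration bound, a trivial linear part means that every [g_i - x_i] involves only
    variables of smaller weight, that is, of later blocks. *)
Lemma M_P (i0 : 'I_n) g : i0.+1 = n ->
  M_ k a g <-> isometry g /\ lin_part g = 1%:M.
Proof.
move=> i0n; split=> [[P [c [degP lowP _ gE]]]|[gI g1]].
  have {}degP i : deg_le (a i) (P i) by apply/oppe_nu_id_le; exact: degP.
  have {}lowP i : depends_only_on (fun j => a j < a i) (P i).
    by apply: depends_sub (lowP i) => j; rewrite block_lt.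
  split.
    apply/isometryP; split; last exact: M_filteredV degP lowP gE.
    by move=> i; rewrite gE; apply: deg_leD => //; exact: deg_leX.
  apply/matrixP => i j; rewrite !mxE gE mcoeffD mcoeffXU.
  case: eqP => [ij|aij]; first by rewrite (lower_coef0 (lowP i)) ?addr0.
  by case: eqP => // ij; case: aij; rewrite ij.
have /isometryP[gF _] := gI.
pose P i := polyaut_comp g i - 'X_i.
have lowP i : depends_only_on (fun j => a j < a i) (P i).
  apply: depends_lower => [|j ij].
    by apply: deg_leB => //; exact: deg_leX.
  have /matrixP/(_ i j) := g1; rewrite !mxE ij eqxx => gij.
  by rewrite mcoeffB mcoeffXU gij subrr.
(* The last variable has least weight, so [P i0] involves no variable and equals its constant
   coefficient. *)
exists P, (P i0)@_0%MM; split=> i.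
- by apply/oppe_nu_id_le/deg_leB => //; exact: deg_leX.
- by apply: depends_sub (lowP i) => j; rewrite block_lt.
- move=> i_n; have -> : i = i0 by apply: val_inj; apply: succn_inj; rewrite i_n.
  apply: depends_none (lowP i0) => j; apply/negbTE; rewrite -leNgt a_noninc //.
  by rewrite -ltnS i0n.
- by rewrite /P addrC subrK.
Qed.

(** A smaller weight forces a larger index, so elements of M are triangular. *)
Lemma Tame_M g : M_ k a g -> Tame g.
Proof.
move=> [P [c [_ lowP _ gE]]]; apply: Tame_triangular gE _ => i.
apply: depends_sub (lowP i) => j; rewrite block_lt => ji.
by rewrite ltnNge; apply: contraTN ji => /a_noninc; rewrite -leNgt.
Qed.

End Weights.

(** * The semidirect decomposition, with M as the kernel of the linear part *)

Theorem proposition3p2 (R : realType) (k : fieldType) (n : nat) (n_ge2 : 2 <= n)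
    (a : 'I_n -> R) (a_Piplus : PiPlus a) :
  is_sdprod (M_ k a) (L_ k a) (tame_stab (nu_id_class k (proj1 a_Piplus))).
Proof.
have a_gt0 := proj1 a_Piplus; have a_noninc := proj2 a_Piplus.
have ltn : (n.-1 < n)%N by rewrite ltn_predL (ltn_trans _ n_ge2).
pose i0 := Ordinal ltn.
have i0n : i0.+1 = n by rewrite /= prednK // (ltn_trans _ n_ge2).
have imin j : (a i0 <= a j)%R by rewrite a_noninc // -ltnS i0n.
have stabP g : tame_stab (nu_id_class k (proj1 a_Piplus)) g <->
  Tame g /\ isometry a g by exact: tame_stabP.
have MP g : M_ k a g <-> isometry a g /\ (lin_part a g = 1%:M)%R.
  exact: M_P i0n.
have LI g : L_ k a g -> isometry a g.
  by move=> /(L_P a_noninc)[A [uA A0 gA]]; exact: linear_isometry uA A0 gA.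
have LT g : L_ k a g -> Tame g.
  by move=> [A [uA _ gA]]; apply: Tame_GL; exists A.
have lpM (g h : polyaut k n) : isometry a g -> isometry a h ->
    lin_part a (g * h)%g = (lin_part a g *m lin_part a h)%R.
  by move=> /isometryP[gF _] /isometryP[hF _]; exact: lin_partM.
have lpV (g : polyaut k n) : isometry a g -> lin_part a (g^-1)%g = invmx (lin_part a g).
  move=> gI; have gu := lin_part_unit a_gt0 gI.
  rewrite -[LHS](mulKmx gu) -(lpM _ _ gI (isometryV gI)).
  by rewrite mulgV lin_part1 mulmx1.
split.
- split=> [|g h /set_mem/stabP[Tg gI] /set_mem/stabP[Th hI]].
    by apply/mem_set/stabP; split; [exact: Tame1|exact: isometry1].
  apply/mem_set/stabP; split; first exact: TameM Tg (TameV Th).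
  exact: isometryM gI (isometryV hI).
- split=> [|g h /set_mem/MP[gI g1] /set_mem/MP[hI h1]].
    by apply/mem_set/MP; split; [exact: isometry1|exact: lin_part1].
  have hVI := isometryV hI.
  apply/mem_set/MP; split; first exact: isometryM gI hVI.
  by rewrite (lpM _ _ gI hVI) (lpV _ hI) g1 h1 invmx1 mulmx1.
- exact: L_subgroup.
- move=> g gM; apply/stabP; split; first exact: Tame_M gM.
  by have /MP[] := gM.
- by move=> g gL; apply/stabP; split; [exact: LT|exact: LI].
(* Normality: conjugating a trivial linear part leaves it trivial. *)
- move=> x h /MP[xI x1] /stabP[_ hI]; have hVI := isometryV hI.
  have xhI := isometryM xI hI.
  rewrite conjgE; apply/MP; split; first exact: isometryM hVI xhI.
  rewrite (lpM _ _ hVI xhI) (lpM _ _ xI hI) (lpV _ hI) x1 mul1mx mulVmx //.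
  exact: lin_part_unit.
(* An element of L is determined by its linear part, which M forces to be the identity. *)
- apply/seteqP; split=> [g [/MP[_ g1] /(L_P a_noninc)[A [_ A0 gA]]]|_ ->].
    have A1 : A = 1%:M%R by rewrite -g1 (lin_part_linear A0 gA).
    by apply: polyaut_ext => i; rewrite gA A1 -linear_of1.
  split; first by apply/MP; split; [exact: isometry1|exact: lin_part1].
  by have [/set_mem] := @L_subgroup R k n a a_noninc.
apply/seteqP; split=> [g /stabP[Tg gI]|_ [m mM [l lL <-]]]; last first.
  have [mI _] := (MP _).1 mM.
  apply/stabP; split; first exact: TameM (Tame_M a_noninc mM) (LT _ lL).
  exact: isometryM mI (LI _ lL).
(* The factor in L is the linear part of [g], seen as an automorphism; dividing by it on the right
   leaves a factor with trivial linear part. *)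
have uA := lin_part_unit a_gt0 gI; pose l := lin_aut uA.
have A0 i j : a i != a j -> lin_part a g i j = 0%R by rewrite mxE => /negPf->.
have lL : L_ k a l by apply/(L_P a_noninc); exists (lin_part a g); split=> //; exact: lin_autP.
have lI := LI _ lL; exists (g * l^-1)%g; last by exists l; rewrite // mulgVK.
have lVI := isometryV lI.
apply/MP; split; first exact: isometryM gI lVI.
by rewrite (lpM _ _ gI lVI) (lpV _ lI) (lin_part_linear A0 (lin_autP uA)) mulmxV.
Qed.
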